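(* Let $I$ be a normally torsion-free square-free monomial ideal in $R=K[x_1,\ldots,x_n]$ with $\mathcal{G}(I)=\{u_1,\ldots,u_m\}$. Let $S=R[x_{n+1},\ldots,x_{n+m}]$, let $f$ be a square-free monomial with $f\mid u_m$, and set $L:=(u_1,\ldots,u_{m-1})S+fx_{n+1}\cdots x_{n+m}S$. Assume $fx_{n+1}\cdots x_{n+m}\notin\mathfrak{p}^2$ for every $\mathfrak{p}\in\mathrm{Min}(L)$ and that $(u_1,\ldots,u_{m-1})S$ is normally torsion-free. Then: (i) $L$ is normally torsion-free; (ii) $L$ is nearly normally torsion-free; (iii) $L$ is normal; (iv) $L$ has the strong persistence property; (v) $L$ has the persistence property; (vi) $L$ has the symbolic strong persistence property.
   Context: $K$ is a field; $\mathcal{G}(I)$ is the minimal monomial generating set; $\mathrm{Min}(L)$ the set of minimal primes. An ideal $I$ is normally torsion-free if $\mathrm{Ass}(R/I^k)\subseteq\mathrm{Ass}(R/I)$ for all $k\ge1$. A monomial ideal $I$ is nearly normally torsion-free if there exist a positive integer $k$ and a monomial prime ideal $\mathfrak{p}$ such that $\mathrm{Ass}(R/I^t)=\mathrm{Min}(I)$ for $1\le t\le k$ and $\mathrm{Ass}(R/I^t)\subseteq\mathrm{Min}(I)\cup\{\mathfrak{p}\}$ for all $t\ge k+1$. $I$ is normal if all powers $I^k$ are integrally closed. Persistence property: $\mathrm{Ass}(R/I^k)\subseteq\mathrm{Ass}(R/I^{k+1})$ for all $k\ge1$; strong persistence property: $(I^{k+1}:I)=I^k$ for all $k\geq1$;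 symbolic strong persistence property: $(I^{(k+1)}:I^{(1)})=I^{(k)}$ for all $k\ge1$, where $I^{(k)}=\bigcap_{\mathfrak{p}\in\mathrm{Min}(I)}(I^kR_\mathfrak{p}\cap R)$. *)

(* Defs.v *)
From HB Require Import structures.
From mathcomp Require Import all_boot all_order all_algebra.
From mathcomp Require Import mpoly.
Set Implicit Arguments. Unset Strict Implicit. Unset Printing Implicit Defensive.
Import GRing.Theory.
Local Open Scope ring_scope.

Section IdealTheory.
Variable R : comRingType.
Notation ideal := (R -> Prop).

Definition ideal_eq (I J : ideal) : Prop := forall r, I r <-> J r.
Definition ideal_sub (I J : ideal) : Prop := forall r, I r -> J r.

Definition is_ideal (I : ideal) : Prop :=
  I 0 /\ (forall a b, I a -> I b -> I (a + b)) /\ (forall c a, I a -> I (c * a)).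

Definition ideal_span (P : R -> Prop) : ideal := fun r =>
  exists (k : nat) (g c : 'I_k -> R), (forall i, P (g i)) /\ r = \sum_(i < k) c i * g i.

Definition idealM (I J : ideal) : ideal :=
  ideal_span (fun r => exists a b, I a /\ J b /\ r = a * b).

Fixpoint idealX (I : ideal) (k : nat) : ideal :=
  match k with
  | 0 => ideal_span (fun r => r = 1)
  | k'.+1 => idealM (idealX I k') I
  end.

Definition colon (J I : ideal) : ideal := fun r => forall a, I a -> J (r * a).

Definition is_prime (P : ideal) : Prop :=
  is_ideal P /\ ~ P 1 /\ (forall a b, P (a * b) -> P a \/ P b).

Definition Ass (I : ideal) (P : ideal) : Prop :=
  is_prime P /\ exists g, forall r, P r <-> I (r * g).

Definition Min (I : ideal) (P : ideal) : Prop :=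
  is_prime P /\ ideal_sub I P /\
  (forall Q, is_prime Q -> ideal_sub I Q -> ideal_sub Q P -> ideal_sub P Q).

Definition normally_torsion_free (I : ideal) : Prop :=
  forall k, (1 <= k)%N -> forall P, Ass (idealX I k) P -> Ass I P.

Definition integral_over (J : ideal) (r : R) : Prop :=
  exists (d : nat) (a : nat -> R), (1 <= d)%N /\
    (forall i, (1 <= i <= d)%N -> idealX J i (a i)) /\
    r ^+ d + \sum_(1 <= i < d.+1) a i * r ^+ (d - i) = 0.

Definition integrally_closed (J : ideal) : Prop :=
  forall r, integral_over J r -> J r.

Definition normal (I : ideal) : Prop :=
  forall k, (1 <= k)%N -> integrally_closed (idealX I k).

Definition persistence (I : ideal) : Prop :=
  forall k, (1 <= k)%N -> forall P, Ass (idealX I k) P -> Ass (idealX I k.+1) P.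

Definition strong_persistence (I : ideal) : Prop :=
  forall k, (1 <= k)%N -> ideal_eq (colon (idealX I k.+1) I) (idealX I k).

(* I^(k) = intersection over p in Min(I) of I^k R_p \cap R;
   for a domain R, I^k R_p \cap R = { r | exists s \notin p, s r \in I^k } *)
Definition symb_pow (I : ideal) (k : nat) : ideal := fun r =>
  forall P, Min I P -> exists s, ~ P s /\ idealX I k (s * r).

Definition symbolic_strong_persistence (I : ideal) : Prop :=
  forall k, (1 <= k)%N ->
    ideal_eq (colon (symb_pow I k.+1) (symb_pow I 1)) (symb_pow I k).

End IdealTheory.

Section Monomials.
Variables (K : fieldType) (n : nat).

Definition is_monomial (r : {mpoly K[n]}) : Prop := exists m : 'X_{1..n}, r = 'X_[m].

Definition monomial_ideal (I : {mpoly K[n]} -> Prop) : Prop :=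
  ideal_eq I (ideal_span (fun x => I x /\ is_monomial x)).

Definition monomial_prime (P : {mpoly K[n]} -> Prop) : Prop :=
  is_prime P /\ monomial_ideal P.

Definition nearly_normally_torsion_free (I : {mpoly K[n]} -> Prop) : Prop :=
  exists (k : nat) (p : {mpoly K[n]} -> Prop), (1 <= k)%N /\ monomial_prime p /\
    (forall t, (1 <= t <= k)%N -> forall P, Ass (idealX I t) P <-> Min I P) /\
    (forall t, (k.+1 <= t)%N -> forall P, Ass (idealX I t) P -> Min I P \/ ideal_eq P p).

Definition mdivides (a b : 'X_{1..n}) : Prop := forall i, (a i <= b i)%N.
Definition squarefree (a : 'X_{1..n}) : Prop := forall i, (a i <= 1)%N.
End Monomials.

Definition mext (n k : nat) (a : 'X_{1..n}) : 'X_{1..n + k} :=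
  [multinom (match split i with inl j => a j | inr _ => 0%N end) | i < n + k].

Definition mnew (n k : nat) : 'X_{1..n + k} :=
  [multinom (match split i with inl _ => 0%N | inr _ => 1%N end) | i < n + k].

(* Main.v *)
(* A square-free monomial ideal is normally torsion-free exactly when each of its
   powers is the intersection of the powers of its minimal primes, i.e. when a
   monomial of weight at least k on every (minimal) vertex cover of the generators
   is divisible by a product of k generators.

   Write v for f x_(n+1) ... x_(n+m); every minimal cover of L contains exactly one
   variable of v. Let w be a monomial of weight at least k on all minimal covers of
   L. If v divides w, then w/v has weight at least k - 1 and induction applies.
   Otherwise some variable x of v does not divide w; adding x to a cover of
   u_1, ..., u_(m-1) gives a cover of L without changing the weight of w, so w lies
   in the k-th power of (u_1, ..., u_(m-1)).

   The six properties of L follow because the order of a polynomial along a set of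
   variables is a valuation. *)
Require Import Defs.
From HB Require Import structures.
From mathcomp Require Import all_boot all_order all_algebra.
From mathcomp Require Import mpoly zify.
From Stdlib Require Import Classical.
Set Implicit Arguments. Unset Strict Implicit. Unset Printing Implicit Defensive.
Import GRing.Theory.
Local Open Scope ring_scope.

(** * Ideals, spans and primes in a commutative ring *)

Section Ideals.
Variable R : comRingType.
Implicit Types (I J P : R -> Prop) (r s : R).

Lemma ideal_sum I (T : Type) (s : seq T) (p : pred T) (F : T -> R) :
  is_ideal I -> (forall i, p i -> I (F i)) -> I (\sum_(i <- s | p i) F i).
Proof.
move=> [I0 [ID _]] IF; elim: s => [|x s IH]; rewrite ?big_nil // big_cons.
by case: ifP => // px; apply: ID => //; apply: IF.
Qed.

Lemma span_sub (G : R -> Prop) I :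
  is_ideal I -> (forall r, G r -> I r) ->
  forall r, ideal_span G r -> I r.
Proof.
move=> idI GI r [k [g [c [Gg ->]]]]; apply: ideal_sum => // i _.
by case: idI => _ [_ IM]; apply/IM/GI/Gg.
Qed.

Lemma span_incl (G : R -> Prop) r : G r -> ideal_span G r.
Proof.
by exists 1%N, (fun=> r), (fun=> 1); rewrite big_ord1 mul1r.
Qed.

Lemma span_is_ideal (G : R -> Prop) : is_ideal (ideal_span G).
Proof.
split; last split.
- by exists 0%N, (fun=> 0), (fun=> 0); split=> [[]|] //; rewrite big_ord0.
- move=> _ _ [k [g [c [Gg ->]]]] [l [h [d [Gh ->]]]].
  exists (k + l)%N,
    (fun i => match split i with inl j => g j | inr j => h j end),
    (fun i => match split i with inl j => c j | inr j => d j end).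
  split=> [i|]; first by case: (split i).
  rewrite big_split_ord /=; congr (_ + _); apply: eq_bigr => i _.
    by rewrite (unsplitK (inl i)).
  by rewrite (unsplitK (inr i)).
- move=> b _ [k [g [c [Gg ->]]]]; exists k, g, (fun i => b * c i).
  by split=> //; rewrite mulr_sumr; apply: eq_bigr => i _; rewrite mulrA.
Qed.

Lemma prime_prod P (T : Type) (s : seq T) (p : pred T) (F : T -> R) :
  is_prime P -> P (\prod_(i <- s | p i) F i) -> exists2 i, p i & P (F i).
Proof.
move=> [_ [P1 PM]]; elim: s => [|x s IH]; rewrite ?big_nil // big_cons.
by case: ifP => // px /PM[Px|/IH //]; exists x.
Qed.

Lemma prime_exp P r k : is_prime P -> P (r ^+ k) -> P r.
Proof.
move=> prP; rewrite -[k]card_ord -prodr_const => /(prime_prod prP).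
by case.
Qed.

Lemma ext_is_prime P P' : ideal_eq P P' -> is_prime P -> is_prime P'.
Proof.
move=> PP' [[P0 [PD PM]] [P1 Pp]]; split; first split; first exact/PP'.
- split=> [a b /PP' Pa /PP' Pb|c a /PP' Pa]; apply/PP'; first exact: PD.
  exact: PM.
- by split=> [/PP' //|a b /PP'/Pp[]] Pa; [left|right]; apply/PP'.
Qed.

Lemma ext_Ass I I' P P' :
  ideal_eq I I' -> ideal_eq P P' -> Ass I P -> Ass I' P'.
Proof.
move=> II' PP' [prP [g Pg]]; split; first exact: (ext_is_prime PP' prP).
by exists g => r; rewrite -PP' Pg II'.
Qed.

End Ideals.

(** * Exponent vectors: weights, vertex covers and products of generators *)

Section Exponents.
Variable N : nat.
Implicit Types (C : {set 'I_N}) (m w e : 'X_{1..N}) (E : seq 'X_{1..N}).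

Definition wt C m : nat := \sum_(i in C) m i.

Lemma wtD C m w : wt C (m + w)%MM = (wt C m + wt C w)%N.
Proof.
by rewrite /wt -big_split /=; apply: eq_bigr => i _; rewrite mnmDE.
Qed.

Lemma wt0 C : wt C 0%MM = 0%N.
Proof. by rewrite /wt big1 // => i _; rewrite mnm0E. Qed.

Lemma wt_le C m w : (w <= m)%MM -> (wt C w <= wt C m)%N.
Proof. by move=> le_wm; rewrite -(submK le_wm) wtD leq_addl. Qed.

Lemma wtB C m w : (w <= m)%MM -> wt C (m - w)%MM = (wt C m - wt C w)%N.
Proof. by move=> le_wm; rewrite -{2}(submK le_wm) wtD addnK. Qed.

Lemma wtU C i : wt C U_(i)%MM = (i \in C).
Proof.
rewrite /wt; under eq_bigr do rewrite mnm1E.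
case: (boolP (i \in C)) => iC.
  by rewrite (bigD1 i) //= eqxx big1 // => j /andP[_ /negPf]; rewrite eq_sym => ->.
by rewrite big1 // => j jC; case: eqP => // ij; rewrite ij jC in iC.
Qed.

Lemma wt_gt0 C m : (0 < wt C m)%N = [exists i in C, (0 < m i)%N].
Proof.
rewrite lt0n sum_nat_eq0 negb_forall_in.
by apply: eq_existsb => i; rewrite lt0n.
Qed.

Lemma leq_wt C m i : i \in C -> (m i <= wt C m)%N.
Proof. by move=> iC; rewrite /wt (bigD1 i) //= leq_addr. Qed.

Lemma wt_sub C C' m : C \subset C' -> (wt C m <= wt C' m)%N.
Proof.
by move=> sCC'; rewrite /wt [leqRHS](big_setID C) /= (setIidPr sCC') leq_addr.
Qed.

Lemma wt_set1U C m i : (wt (i |: C) m <= m i + wt C m)%N.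
Proof.
rewrite /wt; case: (boolP (i \in C)) => iC; last by rewrite big_setU1.
by rewrite (setUidPr _) ?sub1set ?leq_addl.
Qed.

Definition vcover E C : bool := all (fun e => 0 < wt C e)%N E.

Lemma vcover_sub E C C' : C \subset C' -> vcover E C -> vcover E C'.
Proof.
by move=> sCC' /allP cC; apply/allP => e /cC; move/leq_trans; apply; apply: wt_sub.
Qed.

(* [pw E k] is the set of exponents of the monomials of the [k]-th power of the
   ideal generated by the monomials with exponents in [E]. *)
Fixpoint pw E k m : bool :=
  match k with
  | 0 => true
  | k'.+1 => has (fun e => (e <= m)%MM && pw E k' (m - e)%MM) E
  end.

Lemma pwSP E k m :
  reflect (exists e, [/\ e \in E, (e <= m)%MM & pw E k (m - e)%MM]) (pw E k.+1 m).
Proof.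
by apply: (iffP hasP) => [[e ? /andP[]]|[e []]]; exists e => //; apply/andP.
Qed.

Lemma pw1P E m : reflect (exists2 e, e \in E & (e <= m)%MM) (pw E 1 m).
Proof. by apply: (iffP (pwSP _ _ _)) => [[e []]|[e]]; exists e. Qed.

Lemma pw_add E k m e : e \in E -> pw E k m -> pw E k.+1 (m + e)%MM.
Proof.
by move=> eE km; apply/pwSP; exists e; rewrite addmK lem_addl.
Qed.

Lemma pw_up E k m w : (m <= w)%MM -> pw E k m -> pw E k w.
Proof.
elim: k m w => // k IH m w /mnm_lepP le_mw /pwSP[e [eE /mnm_lepP le_em km]].
apply/pwSP; exists e; split=> //.
  by apply/mnm_lepP => i; apply: leq_trans (le_mw i).
by apply: IH km; apply/mnm_lepP => i; rewrite !mnmBE leq_sub2r.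
Qed.

Lemma pw_subset E E' k m : {subset E <= E'} -> pw E k m -> pw E' k m.
Proof.
move=> sEE'; elim: k m => // k IH m /pwSP[e [eE le_em km]].
by apply/pwSP; exists e; split; auto.
Qed.

Lemma pw_wt E C k m : vcover E C -> pw E k m -> (k <= wt C m)%N.
Proof.
move=> /allP cC; elim: k m => // k IH m /pwSP[e [/cC eC le_em /IH]].
by rewrite wtB //; have := wt_le C le_em; lia.
Qed.

(** Each of the [k] square-free generators takes at most one of each variable, so an entry of [w]
    that is at least [k] never runs out. *)
Lemma pw_capped E k m w : (forall e, e \in E -> squarefree e) ->
  (forall i, m i = w i \/ (k <= w i)%N) -> pw E k m -> pw E k w.
Proof.
move=> sqE; elim: k m w => // k IH m w mw /pwSP[e [eE /mnm_lepP le_em km]].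
have le_e1 := sqE e eE; apply/pwSP; exists e; split=> //.
  by apply/mnm_lepP => i; have := mw i; have := le_em i; have := le_e1 i; lia.
apply: IH km => i; rewrite !mnmBE.
by have := mw i; have := le_em i; have := le_e1 i; lia.
Qed.

(** Greedy choice: for some [i] in [C] with [w i] positive, remove the generator private to [i].
    This costs one unit of weight on [C] and at most one in each entry outside [C], which the bound
    [k] there affords. *)
Lemma pw_private E C k w : (forall e, e \in E -> squarefree e) ->
  (forall i, i \in C -> exists2 e, e \in E & forall j, j \in C -> e j = (i == j)) ->
  (forall j, j \notin C -> (k <= w j)%N) -> (k <= wt C w)%N -> pw E k w.
Proof.
move=> sqE priv; elim: k w => // k IH w wN wC.
have /existsP[i /andP[iC wi]] : [exists i in C, (0 < w i)%N].
  by rewrite -wt_gt0; lia.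
have [e eE eC] := priv i iC.
have le_ew : (e <= w)%MM.
  apply/mnm_lepP => j; case: (boolP (j \in C)) => jC.
    by rewrite eC //; case: eqP => // <-.
  by have := wN j jC; have := sqE e eE j; lia.
have we : wt C e = 1%N.
  rewrite -[1%N]/(true : nat) -iC -wtU; apply: eq_bigr => j jC.
  by rewrite mnm1E eC.
apply/pwSP; exists e; split=> //; apply: IH => [j jC|].
  by rewrite mnmBE; have := wN j jC; have := sqE e eE j; lia.
by rewrite wtB //; lia.
Qed.

(** Raising an entry below [k] while staying outside the power lowers the total deficit
    [\sum_i (k - w i)], so the process stops. *)
Lemma maximal_nonmember E k w : ~~ pw E k w ->
  exists w', [/\ (w <= w')%MM, ~~ pw E k w' &
    forall i, (w' i < k)%N -> pw E k (w' + U_(i))%MM].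
Proof.
have [d] := ubnP (\sum_i (k - w i))%N; elim: d w => // d IH w ltd npw.
case: (boolP [exists i, (w i < k)%N && ~~ pw E k (w + U_(i))%MM]).
  case/existsP=> i /andP[wi npwi].
  have [|w' [ww' npw' w'max]] := IH _ _ npwi.
    rewrite -ltnS; apply: leq_trans ltd; rewrite ltnS.
    rewrite (bigD1 i) //= [leqRHS](bigD1 i) //= mnmDE mnm1E eqxx -addSn.
    apply: leq_add; first by lia.
    by apply: leq_sum => j _; rewrite leq_sub2l // mnmDE leq_addr.
  exists w'; split=> //; apply/mnm_lepP => j.
  by apply: leq_trans (mnm_lepP ww' j); rewrite mnmDE leq_addr.
rewrite negb_exists => /forallP wmax; exists w; split; rewrite ?lepm_refl // => i wi.
by have := wmax i; rewrite wi negbK.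
Qed.

(** Removing [i] from [C] uncovers some generator, and that generator meets [C] in [i] only. *)
Lemma min_cover_private E C i : minset (vcover E) C -> i \in C ->
  exists e, [/\ e \in E, (0 < e i)%N & forall j, j \in C -> j != i -> e j = 0%N].
Proof.
move=> /minsetP[cC minC] iC.
have: ~~ vcover E (C :\ i).
  apply/negP => cCi; have := minC _ cCi (subD1set _ _).
  by move/setP/(_ i); rewrite !inE eqxx iC.
case/allPn => e eE; rewrite wt_gt0 negb_exists => /forallP e0.
have {}e0 j : j \in C -> j != i -> e j = 0%N.
  by move=> jC ji; have := e0 j; rewrite !inE ji jC /= -eqn0Ngt => /eqP.
exists e; split=> //.
have := allP cC e eE; rewrite wt_gt0 => /existsP[j /andP[jC ej]].
by case: (eqVneq j i) => [<- //|ji]; rewrite e0 in ej.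
Qed.

(** For square-free [E] this is the max-flow min-cut property of the clutter of supports: a capacity
    [w] packs as many generators as the least weight of a cover. *)
Definition mengerian E : Prop :=
  forall k w, (forall C, minset (vcover E) C -> (k <= wt C w)%N) -> pw E k w.

Lemma mengerian_cons E v : squarefree v -> mengerian E ->
  (forall C, minset (vcover (v :: E)) C -> (wt C v <= 1)%N) -> mengerian (v :: E).
Proof.
move=> sqv mE v1; elim=> // k IH w wC.
case: (boolP (v <= w)%MM) => [le_vw|].
  apply/pwSP; exists v; rewrite mem_head le_vw; split=> //; apply: IH => C mC.
  by rewrite wtB //; have := wC C mC; have := v1 C mC; have := wt_le C le_vw; lia.
move/mnm_lepP => /forallP/forallPn[i vwi].
have {}vwi : (w i < v i)%N by lia.
have wi0 : w i = 0%N by have := sqv i; lia.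
apply: (@pw_subset E) => [e eE|]; first by rewrite inE eE orbT.
apply: mE => C /minsetp cC.
have : vcover (v :: E) (i |: C).
  rewrite /= (vcover_sub (subsetUr _ _) cC) andbT.
  by apply: leq_trans (leq_wt v (setU11 i C)); lia.
case/minset_exists => C' mC' sC'.
apply: leq_trans (wC _ mC') _; apply: leq_trans (wt_sub w sC') _.
by apply: leq_trans (wt_set1U C w i) _; rewrite wi0.
Qed.

End Exponents.

(** Every other term of the convolution has an index below [a] or a complementary index below [b].
    This makes orders add in [Q_mulN]. *)
Lemma coefM_low (A : comNzRingType) (p q : {poly A}) a b :
  (forall j, (j < a)%N -> p`_j = 0) -> (forall j, (j < b)%N -> q`_j = 0) ->
  (p * q)`_(a + b) = p`_a * q`_b.
Proof.
move=> pa qb; have lt_a : (a < (a + b).+1)%N by rewrite ltnS leq_addr.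
rewrite coefM (bigD1 (Ordinal lt_a)) //= addKn big1 ?addr0 // => j /eqP ja.
have {}ja : (j : nat) <> a by move=> eja; apply: ja; apply: val_inj.
case: (ltnP j a) => [/pa ->|le_aj]; first by rewrite mul0r.
by rewrite qb ?mulr0 //; have := ltn_ord j; lia.
Qed.

(** * Monomial ideals and the order of a polynomial along a set of variables *)

Section MonomialIdeals.
Variables (K : fieldType) (N : nat).
Notation S := {mpoly K[N]}.
Implicit Types (C : {set 'I_N}) (m w e : 'X_{1..N}) (E : seq 'X_{1..N}).
Implicit Types (r s : S) (I P : S -> Prop).

Definition mon_in (A : pred 'X_{1..N}) : S -> Prop := fun r => all A (msupp r).

Lemma mon_inX (A : pred 'X_{1..N}) m : mon_in A 'X_[m] <-> A m.
Proof. by rewrite /mon_in msuppX /= andbT. Qed.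

Lemma mon_in_ideal (A : pred 'X_{1..N}) :
  (forall m w, (m <= w)%MM -> A m -> A w) -> is_ideal (mon_in A).
Proof.
move=> upA; split; first by rewrite /mon_in msupp0.
split=> [a b /allP Aa /allP Ab|c a /allP Aa]; apply/allP => m.
  by move=> /msuppD_le; rewrite mem_cat => /orP[/Aa|/Ab].
by move=> /msuppM_le/allpairsP[[w x] /= [_ /Aa Ax ->]]; apply: upA Ax; rewrite lem_addl.
Qed.

Lemma mon_in_sub (A : pred 'X_{1..N}) I :
  is_ideal I -> (forall m, A m -> I 'X_[m]) -> forall r, mon_in A r -> I r.
Proof.
move=> idI AI r /allP Ar; rewrite [r]mpolyE big_seq; apply: ideal_sum => // m /Ar/AI.
by rewrite -mul_mpolyC; case: idI => _ [_]; apply.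
Qed.

Lemma span_mon_in E (G : S -> Prop) :
  (forall r, G r <-> exists2 e, e \in E & r = 'X_[e]) ->
  ideal_eq (ideal_span G) (mon_in (pw E 1)).
Proof.
move=> GE r; split.
  apply: span_sub => [|_ /GE[e eE ->]]; first exact/mon_in_ideal/pw_up.
  by apply/mon_inX/pw1P; exists e; rewrite ?lepm_refl.
apply: mon_in_sub => [|m /pw1P[e eE le_em]]; first exact: span_is_ideal.
rewrite -(submK le_em) mpolyXD; case: (span_is_ideal G) => _ [_]; apply.
by apply/span_incl/GE; exists e.
Qed.

Lemma idealX_mon_in E I k : ideal_eq I (mon_in (pw E 1)) ->
  ideal_eq (idealX I k) (mon_in (pw E k)).
Proof.
move=> IE; elim: k => [|k IH] r /=.
  split=> _; first by apply/allP.
  by rewrite -[r]mulr1; case: (span_is_ideal (eq^~ (1 : S))) => _ [_]; apply; apply: span_incl.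
split.
  apply: span_sub; first exact/mon_in_ideal/(@pw_up _ _ k.+1).
  move=> _ [a [b [/IH/allP Ia [/IE/allP Ib ->]]]]; apply/allP => m.
  move=> /msuppM_le/allpairsP[[w x] /= [/Ia kw /Ib/pw1P[e eE le_ex] ->]].
  apply: (@pw_up _ _ k.+1 (w + e)%MM); last exact: pw_add.
  by apply/mnm_lepP => i; rewrite !mnmDE leq_add2l (mnm_lepP le_ex).
apply: (@mon_in_sub (pw E k.+1)) => [|m /pwSP[e [eE le_em km]]]; first exact: span_is_ideal.
apply: span_incl; exists 'X_[m - e], 'X_[e]; split; first exact/IH/mon_inX.
split; first by apply/IE/mon_inX/pw1P; exists e; rewrite ?lepm_refl.
by rewrite -mpolyXD submK.
Qed.

(* For a vertex cover [C], [Q C k] is the [k]-th power of the prime ideal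
   generated by the variables in [C]. *)
Definition Q C k : S -> Prop := mon_in (fun m => k <= wt C m)%N.

Lemma Q_ideal C k : is_ideal (Q C k).
Proof. by apply: mon_in_ideal => m w /(wt_le C) ? /leq_trans; apply. Qed.

Lemma Q_leq C k l r : (l <= k)%N -> Q C k r -> Q C l r.
Proof. by move=> le_lk; apply: sub_all => m; apply: leq_trans. Qed.

Lemma QM C k l r s : Q C k r -> Q C l s -> Q C (k + l) (r * s).
Proof.
move=> /allP Qr /allP Qs; apply/allP => m /msuppM_le/allpairsP[[w x] /= [/Qr ? /Qs ? ->]].
by rewrite wtD leq_add.
Qed.

Lemma Q_exp C k r d : Q C k r -> Q C (k * d) (r ^+ d).
Proof.
move=> Qr; elim: d => [|d IH]; first by rewrite muln0; apply/allP.
by rewrite exprS mulnS; apply: QM.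
Qed.

(* The grading by [C]-weight: the coefficient of ['X^j] is the component of [r]
   of weight [j]. *)
Definition wpoly C : S -> {poly S} :=
  mmap (polyC \o @mpolyC N K) (fun i => ('X_i : S)%:P * 'X^(i \in C)).

Lemma wpoly_coef C r j m :
  ((wpoly C r)`_j)@_m = (wt C m == j)%:R * r@_m.
Proof.
have mmap1E w : mmap1 (fun i => ('X_i : S)%:P * 'X^(i \in C)) w
    = ('X_[w])%:P * 'X^(wt C w).
  rewrite /mmap1; under eq_bigr do rewrite exprMn -exprM -polyC_exp.
  rewrite big_split /= -rmorph_prod /= -mpolyXE_id prodrXr.
  congr (_ * 'X^_); rewrite /wt [RHS]big_mkcond /=.
  by apply: eq_bigr => i _; case: (i \in C); rewrite ?mul1n ?mul0n.
rewrite /wpoly /mmap coef_sum raddf_sum /= [in RHS](mpolyE r) raddf_sum /= mulr_sumr.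
apply: eq_bigr => w _; rewrite mmap1E mulrA -polyCM mul_mpolyC coefCM coefXn.
rewrite mulr_natr mcoeffMn mcoeffZ mcoeffX.
case: eqP => [->|_]; rewrite ?mulr0 ?mul0rn ?mulr0 // mulr1.
by rewrite mulr_natl eq_sym.
Qed.

Lemma wpolyM C : {morph wpoly C : r s / r * s}.
Proof. exact: rmorphM. Qed.

(** Turns membership into the order of vanishing at 0 of a univariate polynomial over the domain
    [S]. *)
Lemma QP C k r : Q C k r <-> forall j, (j < k)%N -> (wpoly C r)`_j = 0.
Proof.
split=> [/allP Qr j jk|Qr].
  apply/mpolyP => m; rewrite wpoly_coef mcoeff0; case: eqP => [mj|]; rewrite ?mul0r // mul1r.
  by apply: memN_msupp_eq0; apply/negP => /Qr; rewrite mj leqNgt jk.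
apply/allP => m; rewrite mcoeff_msupp leqNgt; apply: contra => /Qr/mpolyP/(_ m).
by rewrite wpoly_coef eqxx mul1r mcoeff0 => ->.
Qed.

Lemma Q_order C k r : ~ Q C k r -> exists2 v, (v < k)%N & Q C v r /\ ~ Q C v.+1 r.
Proof.
elim: k => [|k IH] nQ; first by case: nQ; apply/allP.
case: (boolP (all (fun m => k <= wt C m)%N (msupp r))) => [Qk|/negP /IH [v vk ?]].
  by exists k.
by exists v => //; apply: ltnW.
Qed.

(** The components of lowest weight of [r] and [s] have a nonzero product, because [S] is a domain;
    hence orders along [C] add up. *)
Lemma Q_mulN C a b r s :
  ~ Q C a.+1 r -> ~ Q C b.+1 s -> ~ Q C (a + b).+1 (r * s).
Proof.
have low c t : ~ Q C c.+1 t -> exists v, [/\ (v <= c)%N,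
    forall j, (j < v)%N -> (wpoly C t)`_j = 0 & (wpoly C t)`_v != 0].
  move=> /Q_order[v vc [/QP Qv nQ]]; exists v; split=> //.
  apply: contra_notN nQ => /eqP t0; apply/QP => j; rewrite ltnS leq_eqVlt.
  by case/predU1P => [->|/Qv].
move=> /low[v [va rv rv0]] /low[w [wb sw sw0]] /QP/(_ (v + w)%N).
rewrite ltnS leq_add // => /(_ isT) /eqP.
by rewrite wpolyM coefM_low // mulf_eq0 (negPf rv0) (negPf sw0).
Qed.

Lemma Q_primary C k r g : Q C k (r * g) -> ~ Q C k g -> Q C 1 r.
Proof.
case: k => [|k] Qrg nQ; first by case: nQ; apply/allP.
by apply/negPn/negP => /negP nr; apply: (@Q_mulN C 0 k r g).
Qed.

Lemma Q_cancel C k r g : Q C k.+1 (g * r) -> ~ Q C 2 g -> Q C k r.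
Proof.
case: k => [|k] Qrg nQ; first by apply/allP.
by apply/negPn/negP => /negP nr; apply: (@Q_mulN C 1 k g r).
Qed.

Lemma Q_prime C : is_prime (Q C 1).
Proof.
split; [exact: Q_ideal|split] => [|a b Qab].
  by rewrite /Q /mon_in msupp1 /= wt0.
case: (boolP (all (fun m => 1 <= wt C m)%N (msupp b))) => [|/negP nb]; first by right.
by left; apply: Q_primary Qab nb.
Qed.

Lemma Q_var C i : Q C 1 'X_i <-> i \in C.
Proof. by rewrite /Q mon_inX wtU; case: (i \in C). Qed.

Lemma Q_sub_prime C P :
  is_prime P -> (forall i, i \in C -> P 'X_i) -> ideal_sub (Q C 1) P.
Proof.
move=> [idP _] CP; apply: (@mon_in_sub (fun m => 1 <= wt C m)%N) => // m.
rewrite wt_gt0 => /existsP[i /andP[/CP Pi mi]].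
have le_im : (U_(i) <= m)%MM by rewrite lep1mP -lt0n.
by rewrite -(submK le_im) mpolyXD; case: idP => _ [_]; apply.
Qed.

Lemma Q_monomial C k : monomial_ideal (Q C k).
Proof.
move=> r; split; last by apply: span_sub => [|s []//]; apply: Q_ideal.
apply: (@mon_in_sub (fun m => k <= wt C m)%N) => [|m km]; first exact: span_is_ideal.
by apply: span_incl; split; [apply/mon_inX|exists m].
Qed.

Lemma Q1_vars C : ideal_eq (Q C 1) (mon_in (pw [seq U_(i)%MM | i <- enum C] 1)).
Proof.
move=> r; rewrite /Q /mon_in; under eq_all => m do rewrite wt_gt0.
split; apply: sub_all => m.
  case/existsP => i /andP[iC mi]; apply/pw1P; exists U_(i)%MM.
    by apply/map_f; rewrite mem_enum.
  by rewrite lep1mP -lt0n.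
case/pw1P => _ /mapP[i + ->]; rewrite mem_enum lep1mP -lt0n => iC mi.
by apply/existsP; exists i; rewrite iC.
Qed.

Lemma pw_vars C k m : (k <= wt C m)%N -> pw [seq U_(i)%MM | i <- enum C] k m.
Proof.
elim: k m => // k IH m km.
have /existsP[i /andP[iC mi]] : [exists i in C, (0 < m i)%N] by rewrite -wt_gt0; lia.
have le_im : (U_(i) <= m)%MM by rewrite lep1mP -lt0n.
apply/pwSP; exists U_(i)%MM; split=> //; first by apply/map_f; rewrite mem_enum.
by apply: IH; rewrite wtB // wtU iC; lia.
Qed.

Lemma Q_idealX C k r : Q C k r -> idealX (Q C 1) k r.
Proof.
move=> Qr; apply/(idealX_mon_in k (Q1_vars C)).
by apply: sub_all Qr => m; apply: pw_vars.
Qed.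

Lemma idealX_sub_Q C k I d r :
  (forall s, I s -> Q C k s) -> idealX I d r -> Q C (k * d) r.
Proof.
move=> IQ; elim: d r => [|d IH] r /=; first by rewrite muln0 => _; apply/allP.
apply: span_sub; first exact: Q_ideal.
by move=> _ [a [b [/IH Qa [/IQ Qb ->]]]]; rewrite mulnSr; apply: QM.
Qed.

(** If [r] had order [v < k], then [r ^+ d] would have order exactly [v * d], whereas each other
    term of the integral equation has order at least [k * i + v * (d - i)], which is larger since
    [i] is positive. *)
Lemma Q_integrally_closed C k I r :
  (forall s, I s -> Q C k s) -> integral_over I r -> Q C k r.
Proof.
move=> IQ [d [a [d1 [Ia r0]]]].
apply/negPn/negP => /negP /Q_order[v vk [Qv nQ]].
have: ~ Q C (v * d).+1 (r ^+ d).
  elim: d {d1 Ia r0} => [|d IH]; first by rewrite muln0 expr0; case: (Q_prime C) => _ [].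
  by rewrite exprS mulnS; apply: Q_mulN.
apply; move/eqP: r0; rewrite addr_eq0 => /eqP ->.
rewrite -mulN1r; case: (Q_ideal C (v * d).+1) => _ [_]; apply.
rewrite big_nat; apply: ideal_sum => [|i id]; first exact: Q_ideal.
have Qai : Q C (k * i + v * (d - i)) (a i * r ^+ (d - i)).
  by apply: QM; [apply: idealX_sub_Q (Ia i id)|apply: Q_exp].
by apply: Q_leq Qai; nia.
Qed.

(** * Associated primes of monomial ideals, and the Mengerian property from normal
    torsion-freeness *)

Lemma Ass_Q E I k C w : ideal_eq I (mon_in (pw E 1)) ->
  (forall m, pw E k (w + m)%MM = (0 < wt C m)%N) -> Ass (idealX I k) (Q C 1).
Proof.
move=> IE wP; split; first exact: Q_prime; exists 'X_[w] => r.
rewrite (idealX_mon_in k IE) /mon_in (eq_all_r (perm_mem (msuppMX _ _))) all_map.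
by rewrite /Q /mon_in; under [in X in _ <-> X]eq_all => m do rewrite /= wP.
Qed.

(** Take a monomial [m] of the witness [g] outside [I]. For [j] in [C], a generator dividing
    [m + U_(j)] but not [m] has exponent [m j + 1] at [j]; being square-free, it forces [m j = 0].
    So [m] vanishes on [C], and the generator found for [i] meets [C] in [i] only. *)
Lemma Ass_private E I C i : (forall e, e \in E -> squarefree e) ->
  ideal_eq I (mon_in (pw E 1)) -> Ass I (Q C 1) -> i \in C ->
  exists2 e, e \in E & forall j, j \in C -> e j = (i == j).
Proof.
move=> sqE IE [_ [g gP]] iC.
have [m mg npm] : exists2 m, m \in msupp g & ~~ pw E 1 m.
  apply/allPn/negP => Ig; case: (Q_prime C) => _ [Q1 _]; apply: Q1.
  by apply/gP/IE; rewrite mul1r.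
have one j : j \in C -> exists2 e, e \in E & forall l, (e l <= (j == l) + m l)%N.
  move=> jC; have /gP/IE : Q C 1 'X_j by apply/Q_var.
  rewrite /mon_in mulrC (eq_all_r (perm_mem (msuppMX _ _))) all_map => /allP/(_ _ mg).
  move=> /pw1P[e eE /mnm_lepP le_e]; exists e => // l.
  by have := le_e l; rewrite mnmDE mnm1E.
have top j e : e \in E -> (forall l, (e l <= (j == l) + m l)%N) -> (m j < e j)%N.
  move=> eE le_e; rewrite ltnNge; apply: contra npm => le_ej.
  apply/pw1P; exists e => //; apply/mnm_lepP => l.
  by have := le_e l; case: eqP => // <-.
have m0 j : j \in C -> m j = 0%N.
  by move=> /one[e eE /top-/(_ eE)]; have := sqE e eE j; lia.
have [e eE le_e] := one i iC; exists e => // j jC.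
have := le_e j; rewrite m0 // addn0; case: eqP => [<- _|]; last by case: (e j).
by have := top i e eE le_e; have := sqE e eE i; lia.
Qed.

(* Among the exponents above [w] outside the [k]-th power, take [w'] whose
   entries, capped at [k], are maximal: then [I^k : x^w'] is the prime of the
   variables with exponent below [k] in [w']. Being associated to [I], this prime
   has for each of its variables a generator meeting it in that variable only, and
   these generators multiply to a divisor of [x^w']. *)
Lemma ntf_mengerian E I : (forall e, e \in E -> squarefree e) ->
  ideal_eq I (mon_in (pw E 1)) -> normally_torsion_free I -> mengerian E.
Proof.
move=> sqE IE ntf [|k] w wC //; apply: negbNE; apply/negP.
case/maximal_nonmember => w' [ww' npw w'max].
pose C := [set i | (w' i < k.+1)%N].
have AssC : Ass I (Q C 1).
  apply: (ntf k.+1) => //; apply: (@Ass_Q E _ _ _ w') => // m; rewrite wt_gt0.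
  apply/idP/idP => [kwm|/existsP[i /andP[iC mi]]]; last first.
    apply: pw_up (w'max i _); last by rewrite inE in iC.
    by apply/mnm_lepP => j; rewrite !mnmDE leq_add2l (mnm_lepP _ j) // lep1mP -lt0n.
  (* If [m] vanishes on [C], then [w' + m] differs from [w'] only at entries that are already at
     least [k.+1], so [pw_capped] transfers membership to [w']. *)
  apply: contraNT npw; rewrite negb_exists => /forallP m0.
  apply: pw_capped kwm => // i; rewrite mnmDE.
  by have := m0 i; rewrite inE; lia.
have priv i := Ass_private sqE IE AssC (i := i).
case/negP: npw; apply: (pw_private sqE priv) => [j|]; first by rewrite inE; lia.
(* Each generator multiplies [g] into [I], hence lies in [Q C 1]. A minimal cover inside [C] then
   carries the weight bound from [w] to [w']. *)
have : vcover E C.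
  apply/allP => e eE; apply/(mon_inX (fun m => 0 < wt C m)%N); case: AssC => _ [g gP]; apply/gP/IE.
  rewrite mulrC; have [_ [_]] : is_ideal (mon_in (pw E 1)) by apply/mon_in_ideal/pw_up.
  by apply; apply/mon_inX/pw1P; exists e; rewrite ?lepm_refl.
case/minset_exists => C' /wC kC' sC'.
by apply: leq_trans kC' (leq_trans (wt_sub w sC') (wt_le C ww')).
Qed.

(** * Powers, associated primes and the six properties of a Mengerian ideal *)

Section Mengerian.
Variables (E : seq 'X_{1..N}) (I : S -> Prop).
Hypothesis sqE : forall e, e \in E -> squarefree e.
Hypothesis E_neq0 : E != [::].
Hypothesis IE : ideal_eq I (mon_in (pw E 1)).
Hypothesis mengE : mengerian E.

Let min_cover : pred {set 'I_N} := minset (vcover E).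

Lemma idealX_Q k r : idealX I k r <-> forall C, min_cover C -> Q C k r.
Proof.
split=> [/(idealX_mon_in k IE) Ik C /minsetp cC|QC].
  by apply: sub_all Ik => m; apply: pw_wt.
apply/(idealX_mon_in k IE)/allP => m mr; apply: mengE => C /QC /allP; exact.
Qed.

Lemma idealX1 : ideal_eq (idealX I 1) I.
Proof. by move=> r; rewrite (idealX_mon_in 1 IE) IE. Qed.

Lemma mon_sub_Q C : min_cover C -> ideal_sub I (Q C 1).
Proof.
by move=> /minsetp cC r /IE; apply: sub_all => m; apply: pw_wt.
Qed.

Lemma min_cover_neq0 C : min_cover C -> exists i, i \in C.
Proof.
move=> /minsetp /allP cC; case: E E_neq0 cC => // e E' _ /(_ e (mem_head _ _)).
by rewrite wt_gt0 => /existsP[i /andP[]]; exists i.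
Qed.

(** [P] is the finite intersection of the colons of the [Q C k] by [g], so, being prime, it contains
    one of them. That colon contains all [k]-th powers of elements of [Q C 1], and lies in [Q C 1]
    by [Q_primary]. *)
Lemma Ass_min_cover k P : Ass (idealX I k) P ->
  exists2 C, min_cover C & ideal_eq P (Q C 1).
Proof.
move=> [prP [g gP]]; have [_ [P1 _]] := prP.
have [C mC PC] : exists2 C, min_cover C & forall r, Q C k (r * g) -> P r.
  apply: NNPP => nC.
  (* One element outside [P] is chosen for each minimal cover, with default 1 elsewhere; their
     product contradicts primality. *)
  have /fin_all_exists[F FP] C : exists r, min_cover C -> Q C k (r * g) /\ ~ P r.
    case: (boolP (min_cover C)) => [mC|_]; last by exists 1.
    apply: NNPP => nF; apply: nC; exists C => // r Qr; apply: NNPP => nPr.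
    by apply: nF; exists r.
  have : P (\prod_(C | min_cover C) F C).
    apply/gP/idealX_Q => C mC; rewrite (bigD1 C) //= mulrAC mulrC.
    by case: (Q_ideal C k) => _ [_]; apply; case: (FP C mC).
  by case/(prime_prod prP) => C /FP[].
exists C => // r; split=> [/gP/idealX_Q/(_ C mC) Qrg|Qr].
  apply: Q_primary Qrg _ => Qg; apply/P1/PC; by rewrite mul1r.
apply: (@prime_exp _ P r k) => //; apply: PC.
by have := QM (Q_exp k Qr) (_ : Q C 0 g); rewrite mul1n addn0; apply; apply/allP.
Qed.

Lemma min_cover_Ass k C : (1 <= k)%N -> min_cover C -> Ass (idealX I k) (Q C 1).
Proof.
case: k => // k _ mC; have [i0 i0C] := min_cover_neq0 mC.
(* The weight on [C] is [k], one short of the power [k.+1], and is concentrated at [i0]; the entries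
   [k.+1] outside [C] are those required by [pw_private]. *)
pose w := [multinom if i \in C then (i0 == i) * k else k.+1 | i < N]%N.
have ww : wt C w = k.
  rewrite /wt (bigD1 i0) //= mnmE i0C eqxx mul1n big1 ?addn0 // => i /andP[iC /negPf].
  by rewrite mnmE iC eq_sym => ->.
apply: (Ass_Q (w := w) IE) => m; apply/idP/idP => [|mC0].
  by move=> /(pw_wt (minsetp mC)); rewrite wtD ww; lia.
apply: (@pw_private _ _ C _ _ sqE) => [i iC|j jC|]; last by rewrite wtD ww; lia.
  have [e [eE ei e0]] := min_cover_private mC iC; exists e => // j jC.
  case: eqP => [<-|ij]; last by apply: e0 => //; apply/eqP => ji; apply: ij.
  by have := sqE eE i; lia.
by rewrite mnmDE mnmE (negPf jC) leq_addr.
Qed.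

(** The cover consists of the variables lying in [P]: a prime containing a monomial contains one of
    its variables. *)
Lemma prime_vcover P : is_prime P -> ideal_sub I P ->
  exists2 C, vcover E C & ideal_sub (Q C 1) P.
Proof.
move=> prP IP.
have /fin_all_exists[b bP] i : exists b : bool, b <-> P 'X_i.
  by have [Pi|nPi] := classic (P 'X_i); [exists true|exists false].
exists [set i | b i]; last first.
  by apply: Q_sub_prime => // i; rewrite inE => /bP.
apply/allP => e eE; have : P 'X_[e].
  by apply/IP/IE/mon_inX/pw1P; exists e; rewrite ?lepm_refl.
rewrite mpolyXE_id => /(prime_prod prP)[i _]; rewrite wt_gt0.
case: (posnP (e i)) => [->|ei /(prime_exp prP)/bP bi].
  by rewrite expr0; case: prP => _ [].
by apply/existsP; exists i; rewrite inE bi.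
Qed.

Lemma Min_min_cover P :
  Min I P <-> exists2 C, min_cover C & ideal_eq P (Q C 1).
Proof.
split=> [[prP [IP minP]]|[C mC PC]].
  have [C' /minset_exists[C mC sCC'] QP'] := prime_vcover prP IP.
  have QP : ideal_sub (Q C 1) P.
    by move=> r Qr; apply/QP'/(sub_all _ Qr) => m; move/leq_trans; apply; apply: wt_sub.
  exists C => // r; split; last exact: QP.
  by apply: minP => //; [apply: Q_prime|apply: mon_sub_Q].
split; first by apply: ext_is_prime (Q_prime C) => r; rewrite PC.
split=> [r /(mon_sub_Q mC) /PC //|P' prP' IP' sP'P r /PC].
have [C' cC' QP'] := prime_vcover prP' IP'.
suff <- : C' = C by apply: QP'.
case/minsetP: mC => _; apply=> //; apply/subsetP => i iC'.
by apply/(Q_var C)/PC/sP'P/QP'/Q_var.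
Qed.

Lemma mengerian_ntf : normally_torsion_free I.
Proof.
move=> k k1 P /Ass_min_cover[C mC PC].
apply: (ext_Ass idealX1 _ (min_cover_Ass (leqnn 1) mC)) => r; by rewrite PC.
Qed.

Lemma mengerian_nearly_ntf : nearly_normally_torsion_free I.
Proof.
(* [Q set0 1] is the zero ideal, a monomial prime; the associated primes of all positive powers are
   already minimal primes of [I]. *)
exists 1%N, (Q set0 1); split=> //; split; first by split; [apply: Q_prime|apply: Q_monomial].
split=> [[|[]] // _ P|t _ P /Ass_min_cover /Min_min_cover]; last by left.
split=> [/Ass_min_cover /Min_min_cover //|/Min_min_cover[C mC PC]].
by apply: (ext_Ass _ _ (min_cover_Ass (leqnn 1) mC)) => r; rewrite ?PC.
Qed.

Lemma mengerian_normal : normal I.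
Proof.
move=> k _ r int_r; apply/idealX_Q => C mC.
by apply: Q_integrally_closed int_r => s /idealX_Q; apply.
Qed.

Lemma mengerian_strong_persistence : strong_persistence I.
Proof.
move=> k _ r; split=> [colon_r|Ir a Ia]; last first.
  by apply: span_incl; exists r, a.
apply/idealX_Q => C mC; have [i iC] := min_cover_neq0 mC.
have [e [eE ei e0]] := min_cover_private mC iC.
(* The generator private to [i] has order exactly 1 along [C], so cancelling it costs a single
   power. *)
apply: (@Q_cancel C k r 'X_[e]).
  rewrite mulrC; have /idealX_Q : idealX I k.+1 (r * 'X_[e]); last exact.
  by apply/colon_r/IE/mon_inX/pw1P; exists e; rewrite ?lepm_refl.
rewrite /Q mon_inX /wt (bigD1 i) //= big1 ?addn0 => [|j /andP[jC ji]]; last exact: e0.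
by have := sqE eE i; lia.
Qed.

Lemma mengerian_persistence : persistence I.
Proof.
move=> k k1 P /Ass_min_cover[C mC PC].
by apply: (ext_Ass _ _ (min_cover_Ass (leqW k1) mC)) => r; rewrite ?PC.
Qed.

(** A denominator [s] outside [Q C 1] can be cancelled from membership in [Q C k], which is
    primary. *)
Lemma symb_powE k : ideal_eq (symb_pow I k) (idealX I k).
Proof.
move=> r; split=> [sym_r|Ir P [[_ [P1 _]] _]]; last by exists 1; rewrite mul1r.
apply/idealX_Q => C mC.
have /sym_r[s [ns /idealX_Q/(_ C mC) Qsr]] : Min I (Q C 1).
  by apply/Min_min_cover; exists C.
by apply/negPn/negP => /negP nr; apply: ns; apply: Q_primary Qsr nr.
Qed.

Lemma mengerian_symbolic_strong_persistence : symbolic_strong_persistence I.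
Proof.
move=> k k1 r; rewrite symb_powE -(mengerian_strong_persistence k1 r).
split=> col a.
  by move=> /idealX1 /symb_powE /col /symb_powE.
by move=> /symb_powE /idealX1 /col /symb_powE.
Qed.

End Mengerian.

End MonomialIdeals.

(* Generators u_0, ..., u_m (m.+1 of them; the paper's "m" is m.+1 here,
   u_m of the paper is u ord_max).  R = {mpoly K[n]},
   S = R[x_{n+1},...,x_{n+m+1}] = {mpoly K[n + m.+1]}. *)
Theorem theorem3p8 (K : fieldType) (n m : nat) (u : 'I_m.+1 -> 'X_{1..n})
  (f : 'X_{1..n}) :
  (* G(I) = {u_i} is a minimal monomial generating set of square-free monomials *)
  (forall i, squarefree (u i)) ->
  (forall i j, i != j -> ~ mdivides (u i) (u j)) ->
  (* I is normally torsion-free in R *)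
  normally_torsion_free (ideal_span (fun r : {mpoly K[n]} => exists i, r = 'X_[u i])) ->
  (* f square-free monomial dividing u_m *)
  squarefree f -> mdivides f (u ord_max) ->
  let J : {mpoly K[n + m.+1]} -> Prop :=
    fun r => exists i : 'I_m.+1, i != ord_max /\ r = 'X_[mext m.+1 (u i)] in
  let fx : {mpoly K[n + m.+1]} := 'X_[mext m.+1 f + mnew n m.+1] in
  let L := ideal_span (fun r => J r \/ r = fx) in
  (forall P, Min L P -> ~ idealX P 2 fx) ->
  normally_torsion_free (ideal_span J) ->
  normally_torsion_free L /\
  nearly_normally_torsion_free L /\
  normal L /\
  strong_persistence L /\
  persistence L /\
  symbolic_strong_persistence L.
Proof.
move=> sq_u _ _ sq_f _ J fx L minL ntfJ.
pose EJ := [seq mext m.+1 (u i) | i <- enum 'I_m.+1 & i != ord_max].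
pose v := (mext m.+1 f + mnew n m.+1)%MM.
have sq_mext a : squarefree a -> squarefree (mext m.+1 a).
  by move=> sq_a i; rewrite mnmE; case: (split i).
have sqEJ e : e \in EJ -> squarefree e by case/mapP => i _ ->; apply/sq_mext/sq_u.
have sqv : squarefree v.
  by move=> i; rewrite !mnmE; case: (split i) => j; rewrite ?addn0 ?add0n.
have JE r : J r <-> exists2 e, e \in EJ & r = 'X_[e].
  split=> [[i [im ->]]|[_ /mapP[i + ->] ->]].
    by exists (mext m.+1 (u i)) => //; apply: map_f; rewrite mem_filter im mem_enum.
  by rewrite mem_filter => /andP[im _]; exists i.
have LE : ideal_eq L (mon_in (pw (v :: EJ) 1)).
  apply: span_mon_in => r; split=> [[/JE[e eE ->]|->]|[e]].
  - by exists e => //; rewrite inE eE orbT.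
  - by exists v => //; apply: mem_head.
  rewrite inE => /predU1P[->|eE] ->; first by right.
  by left; apply/JE; exists e.
have sqE e : e \in v :: EJ -> squarefree e.
  by rewrite inE => /predU1P[->|/sqEJ].
have mengE : mengerian (v :: EJ).
  apply: mengerian_cons sqv (ntf_mengerian sqEJ (span_mon_in JE) ntfJ) _ => C mC.
  (* A weight of at least 2 on [C] would put [fx] in the square of the minimal prime [Q C 1]. *)
  rewrite leqNgt; apply/negP => v2; apply: (minL (Q C 1)).
    by apply/(Min_min_cover LE); exists C.
  by apply: Q_idealX; apply/mon_inX.
split; first exact: (mengerian_ntf sqE _ LE mengE).
split; first exact: (mengerian_nearly_ntf sqE _ LE mengE).
split; first exact: (mengerian_normal LE mengE).
split; first exact: (mengerian_strong_persistence sqE _ LE mengE).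
split; first exact: (mengerian_persistence sqE _ LE mengE).
exact: (mengerian_symbolic_strong_persistence sqE _ LE mengE).
Qed.
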